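(* Let $G$ be an unweighted 1-2 tree and let $p_c$ be its critical exponent. Then: (1) if $p_c>2$, the simple random walk on $G$ is transient; (2) if $p_c<2$, the simple random walk on $G$ is recurrent.
   Context: A rooted tree with root $o$: the generation of an edge $e$ is the number of edges on the unique path from $o$ ending with $e$; $e$ is the parent of $e'$ ($e'$ a child of $e$) if they are adjacent and $e'$ has generation one more. A proper infinite tree is infinite, locally finite, and every edge has at least one child; it is radially symmetric if the number of children of an edge depends only on its generation. A 1-2 tree is a radially symmetric proper infinite tree in which every edge has one or two children. A descending path is a path $e_1e_2\cdots$ from $o$ with $e_i$ the parent of $e_{i+1}$; $\Gamma_\infty$ is the set of infinite descending paths. For $\rho:E\to[0,\infty)$, $\ell_\rho(\gamma)=\sum_{e\in\gamma}\rho(e)$; $\rho$ is admissible if $\ell_\rho(\gamma)\ge1$ for all $\gamma\in\Gamma_\infty$. For $1<p<\infty$, $\mathrm{Mod}_{p,1}(\Gamma_\infty)=\inf\{\sum_{e\in E}\rho(e)^p:\rho\text{ admissible}\}$. The critical exponent is $p_c=\sup\{p>1:\mathrm{Mod}_{p,1}(\Gamma_\infty)>0\}$ (equal to $1$ if the set is empty). The simple random walk moves from a vertex to a uniformly chosen neighbor. *)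

(* Defs.v *)
From HB Require Import structures.
From mathcomp Require Import all_boot all_order all_algebra finmap.
From mathcomp Require Import all_classical all_reals all_analysis.

Set Implicit Arguments.
Unset Strict Implicit.
Unset Printing Implicit Defensive.

Import Order.TTheory GRing.Theory Num.Theory.

Local Open Scope classical_set_scope.
Local Open Scope ring_scope.

Record rooted_graph (V : choiceType) := RootedGraph {
  adj : rel V;
  root : V
}.

Section RootedTrees.
Variables (V : choiceType) (G : rooted_graph V).

(* [u :: p] is the list of vertices of a simple path. *)
Definition simple_path (u : V) (p : seq V) : Prop :=
  path (adj G) u p /\ uniq (u :: p).

Definition is_tree : Prop :=
  [/\ symmetric (adj G),
      irreflexive (adj G) &
      forall u v, exists! p, simple_path u p /\ last u p = v].

Definition neighbors (u : V) : set V := [set v | adj G u v].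

Definition degree (u : V) : nat := #|` fset_set (neighbors u)|.

Definition locally_finite : Prop := forall u, finite_set (neighbors u).

(* Edges are unordered pairs of adjacent vertices. *)
Definition edges : set {fset V} :=
  [set e | exists u v, adj G u v /\ e = [fset u; v]%fset].

Definition path_edges (u : V) (p : seq V) : seq {fset V} :=
  pairmap (fun v w => [fset v; w]%fset) u p.

Definition root_path_to (e : {fset V}) (p : seq V) : Prop :=
  simple_path (root G) p /\ exists s, path_edges (root G) p = rcons s e.

(* In a tree every edge [e] has exactly one path [root_path_to e p], so the
   default value [[::]] is irrelevant on [edges]. *)
Definition generation (e : {fset V}) : nat :=
  size (path_edges (root G) (xget [::] [set p | root_path_to e p])).

Definition parent (e e' : {fset V}) : Prop :=
  [/\ edges e, edges e',
      e <> e' /\ (exists v, v \in e /\ v \in e') &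
      generation e' = (generation e).+1].

Definition children (e : {fset V}) : set {fset V} := [set e' | parent e e'].

(* [children e] is finite as soon as the tree is locally finite. *)
Definition num_children (e : {fset V}) : nat := #|` fset_set (children e)|.

Definition proper_infinite_tree : Prop :=
  [/\ is_tree, infinite_set [set: V], locally_finite &
      forall e, edges e -> children e !=set0].

Definition radially_symmetric : Prop :=
  forall e e', edges e -> edges e' -> generation e = generation e' ->
    num_children e = num_children e'.

Definition one_two_tree : Prop :=
  [/\ proper_infinite_tree, radially_symmetric &
      forall e, edges e -> num_children e = 1%N \/ num_children e = 2%N].

Definition infinite_descending_path (g : nat -> {fset V}) : Prop :=
  [/\ edges (g 0%N), root G \in g 0%N & forall i, parent (g i) (g i.+1)].

Section Modulus.
Variable R : realType.
Local Open Scope ereal_scope.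

Definition path_length (rho : {fset V} -> R) (g : nat -> {fset V}) : \bar R :=
  \sum_(0 <= i <oo) (rho (g i))%:E.

(* Only the values of [rho] on [edges] matter. *)
Definition admissible (rho : {fset V} -> R) : Prop :=
  (forall e, edges e -> (0 <= rho e)%R) /\
  (forall g, infinite_descending_path g -> 1 <= path_length rho g).

Definition modulus (p : R) : \bar R :=
  ereal_inf [set \esum_(e in edges) (rho e `^ p)%:E | rho in admissible].

Definition positive_exponents : set R :=
  [set p | (1 < p)%R /\ 0 < modulus p].

Definition critical_exponent : \bar R :=
  if positive_exponents == set0 then 1
  else ereal_sup [set p%:E | p in positive_exponents].

Definition srw_step (u v : V) : R :=
  if adj G u v then ((degree u)%:R^-1)%R else 0%R.

Definition history (T : Type) (X : nat -> T -> V) (v : nat -> V) (n : nat) :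
  set T := [set t | forall i, (i <= n)%N -> X i t = v i].

(* The third clause says that, given any history of positive probability up to
   time [n], the next vertex is a uniformly chosen neighbor of [X n]. *)
Definition simple_random_walk (d : measure_display) (T : measurableType d)
    (P : probability T R) (X : nat -> T -> V) (x : V) : Prop :=
  [/\ forall n v, measurable [set t | X n t = v],
      P [set t | X 0%N t = x] = 1 &
      forall n (v : nat -> V),
        P (history X v n.+1) = P (history X v n) * (srw_step (v n) (v n.+1))%:E].

Definition returns (T : Type) (X : nat -> T -> V) (x : V) : set T :=
  [set t | exists n, (0 < n)%N /\ X n t = x].

Definition srw_recurrent : Prop :=
  forall (d : measure_display) (T : measurableType d) (P : probability T R)
    (X : nat -> T -> V) (x : V),
  simple_random_walk P X x -> P (returns X x) = 1.

Definition srw_transient : Prop :=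
  forall (d : measure_display) (T : measurableType d) (P : probability T R)
    (X : nat -> T -> V) (x : V),
  simple_random_walk P X x -> P (returns X x) < 1.

End Modulus.
End RootedTrees.

(* Main.v *)
Require Import Defs.
From mathcomp Require Import all_boot all_order all_algebra finmap.
From mathcomp Require Import all_classical all_reals all_analysis.
From mathcomp Require Import ring lra zify.
(* Makes [root] denote [Defs.root] instead of the polynomial [root]. *)
Import Defs.

(* Let [N_n] be the number of edges of generation [n].  The function
   [sum_(1 <= j <= n) 1 / N_j] of the depth [n] is harmonic off the root, and
   both sides of the theorem are governed by whether it is bounded.

   If it is unbounded, then [rho = 1 / (N_n S)] on the first generations, with [S]
   the truncated sum, has total length 1 on every path and energy at most [1 / S],
   so [Mod_p = 0] for [p >= 2].  If it is bounded, start from an admissible [rho] of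
   small 2-energy and go down the tree, choosing at each vertex a child whose
   subtree carries the least energy: along this path [sum N_n rho^2] is at most the
   total energy, and Cauchy-Schwarz makes the path too short; so [Mod_2 > 0].

   On the probabilistic side, the probability [F y] of ever visiting [x] from [y]
   is superharmonic.  In the unbounded case, the minimum principle applied to [F]
   plus a small multiple of the potential shows that [F] is minimal at the root,
   hence constant.  In the bounded case, truncating an affine function of the
   potential gives a superharmonic majorant of [F] that drops below 1 at the children
   of [x]. *)

Set Implicit Arguments.
Unset Strict Implicit.
Unset Printing Implicit Defensive.

Import Order.TTheory GRing.Theory Num.Theory numFieldNormedType.Exports.

Local Open Scope classical_set_scope.
Local Open Scope ring_scope.

(** * Unordered pairs and finite sequences *)

Lemma fset2_eq (K : choiceType) (a b c d : K) : ([fset a; b] = [fset c; d])%fset ->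
  (a = c /\ b = d) \/ (a = d /\ b = c).
Proof.
move=> h.
have := fset21 a b; have := fset22 a b; rewrite h !inE.
have := fset21 c d; have := fset22 c d; rewrite -h !inE.
by do 4![case/orP=> /eqP ?]; subst; intuition.
Qed.

Lemma exists_le_mean (R : realDomainType) (T : eqType) (s : seq T) (f : T -> R) :
  s != [::] ->
  exists2 x, x \in s & (size s)%:R * f x <= \sum_(y <- s) f y.
Proof.
elim: s => // x s IH _; have [->|/IH[y ys fy]] := eqVneq s [::].
  by exists x; rewrite ?mem_head// big_seq1 mul1r.
rewrite big_cons /=; have [xy|yx] := leP (f x) (f y).
  exists x; first exact: mem_head.
  rewrite -natr1 mulrDl mul1r addrC lerD2l (le_trans _ fy)// ler_wpM2l//.
exists y; first by rewrite in_cons ys orbT.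
by rewrite -natr1 mulrDl mul1r addrC lerD// ltW.
Qed.

Lemma exists_min (R : realDomainType) (T : eqType) (s : seq T) (f : T -> R) :
  s != [::] ->
  exists2 x, x \in s & {in s, forall y, f x <= f y}.
Proof.
elim: s => // x s IH _; have [->|/IH[y ys fy]] := eqVneq s [::].
  by exists x; rewrite ?mem_head// => y; rewrite mem_seq1 => /eqP->.
have [xy|yx] := leP (f x) (f y).
  exists x; first exact: mem_head.
  by move=> z; rewrite inE => /predU1P[->//|/fy]; exact: le_trans.
exists y; first by rewrite in_cons ys orbT.
by move=> z; rewrite inE => /predU1P[->|/fy//]; exact: ltW.
Qed.

(** * Vertices of a rooted tree: root paths, parents and children *)

Section TreeVertices.
Variables (V : choiceType) (G : rooted_graph V).
Local Notation o := (root G).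

Definition pth (v : V) : seq V :=
  xget [::] [set p | simple_path G o p /\ last o p = v].

Definition depth (v : V) : nat := size (pth v).

(** The root becomes its own parent, through the truncated predecessor and the default of [last];
    hence the guards [v != o] below. *)
Definition par (v : V) : V := last o (take (depth v).-1 (pth v)).

Definition nb (v : V) : seq V := fset_set (neighbors G v).

Definition ch (v : V) : seq V := [seq w <- nb v | depth w == (depth v).+1].

Definition edge_above (v : V) : {fset V} := [fset par v; v]%fset.

Hypothesis tree : is_tree G.
Hypothesis locfin : locally_finite G.

Lemma pthP v : simple_path G o (pth v) /\ last o (pth v) = v.
Proof.
rewrite /pth; case: xgetP => [p _ []//|/=].
by case: tree => _ _ /(_ o v)[p [/[swap] _ h]] /(_ p).
Qed.

Lemma pth_simple v : simple_path G o (pth v).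
Proof. by case: (pthP v). Qed.

Lemma last_pth v : last o (pth v) = v.
Proof. by case: (pthP v). Qed.

Lemma pthE v p : simple_path G o p -> last o p = v -> pth v = p.
Proof.
move=> sp pv; case: tree => _ _ /(_ o v)[q [_ qP]].
by rewrite -(qP _ (conj sp pv)) -(qP _ (pthP v)).
Qed.

Lemma pth_root : pth o = [::].
Proof. exact: pthE. Qed.

Lemma depth_root : depth o = 0%N.
Proof. by rewrite /depth pth_root. Qed.

Lemma depth0 v : depth v = 0%N -> v = o.
Proof. by rewrite /depth => /eqP/nilP h; rewrite -(last_pth v) h. Qed.

Lemma adjC u v : adj G u v = adj G v u.
Proof. by case: tree => + _ _; exact. Qed.

Lemma pth_rcons u v : adj G u v -> v \notin o :: pth u -> pth v = rcons (pth u) v.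
Proof.
move=> uv vu; have [pu uu] := pth_simple u.
apply: pthE; rewrite ?last_rcons//; split.
  by rewrite rcons_path pu last_pth.
by rewrite -rcons_cons rcons_uniq vu.
Qed.

Lemma pth_prefix u v : v \in o :: pth u -> pth v = take (depth v) (pth u).
Proof.
rewrite inE => /predU1P[->|]; first by rewrite depth_root take0 pth_root.
rewrite /depth; have := pth_simple u; move=> + vp; case/splitPr: vp => p1 p2 [].
rewrite -cat_rcons cat_path -cat_cons cat_uniq => /andP[pp _] /andP[uu _].
by rewrite (@pthE v (rcons p1 v)) ?last_rcons// take_size_cat.
Qed.

(** If neither path extends the other, each endpoint lies on the path to the other one, so each path
    is a prefix of the other; then [u = v], against irreflexivity. *)
Lemma adj_pth u v : adj G u v ->
  pth v = rcons (pth u) v \/ pth u = rcons (pth v) u.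
Proof.
move=> uv; have [vu|?] := boolP (v \in o :: pth u); last by left; exact: pth_rcons.
right; apply: pth_rcons; first by rewrite adjC.
apply/negP => uv'; have hv := pth_prefix vu; have hu := pth_prefix uv'.
have e : depth u = depth v.
  apply/eqP; rewrite eqn_leq; apply/andP; split; rewrite {1}/depth.
    by rewrite hu size_take_min geq_minr.
  by rewrite hv size_take_min geq_minr.
have : u = v.
  rewrite -(last_pth u) -(last_pth v) hv -e take_oversize//.
by move=> uv''; move: uv; rewrite -uv''; case: tree => _ ->.
Qed.

Lemma parP v : v != o -> adj G (par v) v /\ pth v = rcons (pth (par v)) v.
Proof.
rewrite /par /depth => vo; move: (pth_simple v) (last_pth v).
case/lastP: (pth v) => [_ /= h|q w]; first by rewrite h eqxx in vo.
rewrite last_rcons => -[pq uq] <-.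
have -> : take (size (rcons q w)).-1 (rcons q w) = q.
  by rewrite size_rcons /= -cats1 take_size_cat.
move: pq; rewrite rcons_path => /andP[pq ->]; split => //.
rewrite (@pthE _ q)//; split => //.
by move: uq; rewrite -rcons_cons rcons_uniq => /andP[].
Qed.

Lemma adj_par v : v != o -> adj G (par v) v.
Proof. by case/parP. Qed.

Lemma depth_par v : v != o -> depth v = (depth (par v)).+1.
Proof. by case/parP => _; rewrite /depth => {1}->; rewrite size_rcons. Qed.

Lemma adj_cases u v : adj G u v ->
  (v != o /\ u = par v) \/ (u != o /\ v = par u).
Proof.
move=> uv; wlog h : u v uv / pth v = rcons (pth u) v.
  move=> H; case/adj_pth: (uv) => e; first exact: H.
  by rewrite or_comm; apply: H; rewrite // adjC.
left; have vo : v != o.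
  by apply/eqP => vo; move: h; rewrite {1}vo pth_root; case: (pth u).
split=> //; have [_] := parP vo; rewrite h => /rcons_inj[/(congr1 (last o))].
by rewrite !last_pth.
Qed.

Lemma mem_nb u v : (v \in nb u) = adj G u v.
Proof.
rewrite /nb; apply/idP/idP; rewrite in_fset_set//; first by rewrite inE.
by move=> h; rewrite inE.
Qed.

Lemma nb_uniq u : uniq (nb u).
Proof. exact: fset_uniq. Qed.

Lemma mem_ch u v : (v \in ch u) = (v != o) && (u == par v).
Proof.
rewrite mem_filter mem_nb; apply/idP/idP => [/andP[/eqP d /adj_cases[]]|].
- by move=> [-> ->]; rewrite eqxx.
- by move=> [uo vu]; move: (depth_par uo); rewrite -vu d => /eqP; lia.
- by move=> /andP[vo /eqP->]; rewrite -depth_par// adj_par// eqxx.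
Qed.

Lemma ch_uniq u : uniq (ch u).
Proof. exact/filter_uniq/nb_uniq. Qed.

Lemma depth_ch u v : v \in ch u -> depth v = (depth u).+1.
Proof. by rewrite mem_filter => /andP[/eqP]. Qed.

Lemma nb_perm v : v != o -> perm_eq (nb v) (par v :: ch v).
Proof.
move=> vo; apply: uniq_perm; first exact: nb_uniq.
  rewrite /= ch_uniq mem_ch negb_and andbT; apply/orP.
  have [|h] := boolP (par v == o); [by left|right].
  apply/eqP => e; have := depth_par h; rewrite -e (depth_par vo) => /eqP; lia.
move=> w; rewrite mem_nb in_cons mem_ch; apply/idP/idP.
  by move=> /adj_cases[[-> ->]|[_ ->]]; rewrite eqxx ?orbT.
by move=> /orP[/eqP->|/andP[wo /eqP->]]; rewrite ?adj_par// adjC adj_par.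
Qed.

Lemma nb_size v : v != o -> size (nb v) = (size (ch v)).+1.
Proof. by move=> /nb_perm/perm_size. Qed.

Lemma big_nb (R : nmodType) (f : V -> R) v : v != o ->
  \sum_(w <- nb v) f w = f (par v) + \sum_(w <- ch v) f w.
Proof. by move=> vo; rewrite (perm_big _ (nb_perm vo)) big_cons. Qed.

(** * Edges *)

Lemma edge_above_edges v : v != o -> edges G (edge_above v).
Proof. by move=> vo; exists (par v), v; split => //; exact: adj_par. Qed.

Lemma edges_above e : edges G e -> exists2 v, v != o & e = edge_above v.
Proof.
move=> [u [v [/adj_cases[[vo ->]|[uo ->]] ->]]]; first by exists v.
by exists u => //; rewrite /edge_above fsetUC.
Qed.

Lemma edge_above_inj u v : u != o -> v != o -> edge_above u = edge_above v -> u = v.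
Proof.
move=> uo vo /fset2_eq[[]//|[h1 h2]].
by move: (depth_par uo) (depth_par vo); rewrite h1 -h2 => -> /eqP; lia.
Qed.

Lemma generation_above v : v != o -> generation G (edge_above v) = depth v.
Proof.
move=> vo; rewrite /generation; case: xgetP => [p _ [] sp [s]|]; last first.
  move=> /(_ (pth v))[]; split; first exact: pth_simple.
  have [_ h] := parP vo; exists (path_edges o (pth (par v))).
  by rewrite h /path_edges -cats1 pairmap_cat last_pth /= cats1.
case/lastP: p sp => [_|q w sp].
  by move=> /(congr1 size)/=; rewrite size_rcons.
rewrite /path_edges -cats1 pairmap_cat /= cats1 size_rcons size_pairmap.
move=> /rcons_inj[_ /fset2_eq[[h1 h2]|[h1 h2]]].
  by rewrite -h2 /depth (pthE sp) ?last_rcons// size_rcons.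
(* In this orientation the path goes from [v] to its parent, so the parent would be deeper than
   [v]. *)
have wp := pthE sp (last_rcons _ _ _).
have qp : pth (last o q) = q.
  apply: pthE => //; case: sp; rewrite -cats1 cat_path -cat_cons cat_uniq.
  by move=> /andP[? _] /andP[].
move: (depth_par vo); rewrite -h2 -h1 /depth wp qp size_rcons.
by move=> /eqP; lia.
Qed.

Lemma children_above v : v != o ->
  children G (edge_above v) = edge_above @` [set` ch v].
Proof.
move=> vo; apply/seteqP; split => [e' [_ /edges_above[w wo ->]] [ne [x []]]|].
  rewrite !generation_above// => xv xw dw; exists w => //=.
  (* Two edges can share a vertex in four ways; since [w] is one deeper than [v], the depths leave
     only [v = par w]. *)
  rewrite mem_ch wo/=; move: xv xw; rewrite !inE.
  have := depth_par wo; have := depth_par vo.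
  move=> dv dw' /orP[]/eqP xv /orP[]/eqP xw; have := congr1 depth xw; rewrite xv.
  - by lia.
  - by lia.
  - by move=> _; rewrite -xv xw.
  - by lia.
move=> _ [w /= wv <-]; move: (depth_ch wv).
move: wv; rewrite mem_ch => /andP[wo /eqP vw] dw.
split; [exact: edge_above_edges|exact: edge_above_edges| |by rewrite !generation_above].
split; last by exists v; rewrite !inE -vw eqxx orbT.
by move=> /(edge_above_inj vo wo) e; move/eqP: dw; rewrite e; lia.
Qed.

Lemma num_children_above v : v != o -> num_children G (edge_above v) = size (ch v).
Proof.
move=> vo; rewrite /num_children children_above//.
rewrite fset_set_image; last exact: finite_seq.
rewrite card_in_imfset => [|x y].
  apply/perm_size/uniq_perm; [exact: fset_uniq|exact: ch_uniq|move=> x].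
  by rewrite in_fset_set; [rewrite mem_setE|exact: finite_seq].
rewrite !in_fset_set; try exact: finite_seq.
rewrite !inE /= !mem_ch => /andP[xo _] /andP[yo _].
exact: edge_above_inj.
Qed.

End TreeVertices.

(** * Hitting probabilities *)

Section Hitting.
Variables (V : choiceType) (G : rooted_graph V) (R : realType).
Local Notation nb := (nb G).

Definition mean (f : V -> R) v : R := (\sum_(w <- nb v) f w) / (size (nb v))%:R.

(* [hit x n y] is the probability that the walk started at [y] visits [x]
   at some time [i <= n]. *)
Fixpoint hit x n y : R :=
  if y == x then 1 else if n is m.+1 then mean (hit x m) y else 0.

Lemma hit_id x n : hit x n x = 1. Proof. by case: n => [|n] /=; rewrite eqxx. Qed.

Lemma hitS x n y : y != x -> hit x n.+1 y = mean (hit x n) y.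
Proof. by move=> /negbTE /= ->. Qed.

Lemma le_mean f g v : (forall w, f w <= g w) -> mean f v <= mean g v.
Proof. by move=> fg; rewrite ler_wpM2r ?invr_ge0// ler_sum. Qed.

Lemma mean_ge0 f v : (forall w, 0 <= f w) -> 0 <= mean f v.
Proof. by move=> f0; rewrite divr_ge0// sumr_ge0. Qed.

Lemma hit_ge0 x n y : 0 <= hit x n y.
Proof. by elim: n y => [|n IH] y /=; case: ifP => // _; exact: mean_ge0. Qed.

Lemma hit_nondecreasing x y : nondecreasing_seq (fun n => hit x n y).
Proof.
apply/nondecreasing_seqP => n; elim: n y => [|n IH] y.
  have [->|yx] := eqVneq y x; first by rewrite !hit_id.
  by rewrite hitS// /= (negbTE yx); apply: mean_ge0 => w; exact: (hit_ge0 x 0).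
have [->|yx] := eqVneq y x; first by rewrite !hit_id.
by rewrite !hitS//; exact: le_mean.
Qed.

Hypothesis locfin : locally_finite G.
Hypothesis nb_neq0 : forall v, nb v != [::].

Lemma size_nb_gt0 v : 0 < (size (nb v))%:R :> R.
Proof. by rewrite ltr0n lt0n size_eq0. Qed.

Lemma mean_cst c v : mean (fun=> c) v = c.
Proof.
rewrite /mean big_const_seq count_predT iter_addr_0 -[c *+ _]mulr_natr mulfK//.
by rewrite gt_eqF// size_nb_gt0.
Qed.

Lemma hit_le1 x n y : hit x n y <= 1.
Proof.
elim: n y => [|n IH] y /=; case: ifP => // _.
by rewrite -[leRHS](mean_cst 1 y) le_mean.
Qed.

(** * Comparison of an actual walk with [hit] *)

Section Walk.
Context (d : measure_display) (T : measurableType d) (P : probability T R)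
  (X : nat -> T -> V) (x : V).
Hypothesis walk : simple_random_walk G P X x.

Let mX n v : measurable [set t | X n t = v]. Proof. by case: walk. Qed.

Lemma measurable_history v n : measurable (history X v n).
Proof.
rewrite (_ : history X v n = \bigcap_(i in [set i | (i <= n)%N]) [set t | X i t = v i]).
  exact: bigcap_measurableType.
by apply/seteqP; split=> t /= h i; exact: h.
Qed.

(** The law of the walk is prescribed along whole sequences of vertices, so appending [w] to a
    history means overwriting entry [n.+1]. *)
Lemma history_update v n w :
  history X (fun i => if i == n.+1 then w else v i) n.+1 =
  history X v n `&` [set t | X n.+1 t = w].
Proof.
apply/seteqP; split=> [t h|t [h hw] i].
  split; last by have := h n.+1 (leqnn _); rewrite eqxx.
  by move=> i ni; have := h i (leqW ni); rewrite ltn_eqF// ltnS.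
by rewrite leq_eqVlt => /predU1P[->|ni]; [rewrite eqxx|rewrite ltn_eqF//; exact: h].
Qed.

Lemma history_updateE v n w :
  P (history X v n `&` [set t | X n.+1 t = w]) =
  (P (history X v n) * (srw_step G R (v n) w)%:E)%E.
Proof.
rewrite -history_update; case: walk => _ _ ->; rewrite eqxx ltn_eqF//.
congr (P _ * _)%E.
apply/seteqP; split=> t h i ni.
  by rewrite h// ltn_eqF// ltnS.
by rewrite h// ltn_eqF// ltnS.
Qed.

Lemma measurable_fiber n (s : seq V) : measurable [set t | X n t \in s].
Proof.
rewrite (_ : [set t | _] = \bigcup_(w in [set` s]) [set t | X n t = w]).
  by apply: fin_bigcup_measurable => //; exact: finite_seq.
apply/seteqP; split=> t /=; first by exists (X n t).
by move=> [w ? ->].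
Qed.

(** The part of [H] outside [B] is null. This inserts facts that hold only almost surely: the
    starting vertex, and the next vertex being one of finitely many neighbors. *)
Lemma measure_conull (H A B : set T) : measurable H -> measurable A -> measurable B ->
  P (H `&` B) = P H -> P (H `&` A) = P (H `&` A `&` B).
Proof.
have DI C D : measurable C -> measurable D -> P C = (P (C `\` D) + P (C `&` D))%E.
  exact: measureDI.
move=> mH mA mB HB; rewrite (DI (H `&` A) B)//; last exact: measurableI.
suff -> : P (H `&` A `\` B) = 0%E by rewrite add0e.
apply: (@subset_measure0 _ _ _ P _ (H `\` B)) => //.
- by apply: measurableD => //; exact: measurableI.
- exact: measurableD.
- by move=> t [[Ht _] Bt]; split.
have := DI _ _ mH mB; rewrite HB => /(congr1 (fun z => z - P H)%E).
by rewrite addeK ?subee ?fin_num_measure.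
Qed.

Lemma sum_measure_fiber n (D : set T) (s : seq V) : measurable D -> uniq s ->
  P (D `&` [set t | X n t \in s]) = (\sum_(w <- s) P (D `&` [set t | X n t = w]))%E.
Proof.
move=> mD; have mI w : measurable (D `&` [set t | X n t = w]) by exact: measurableI.
elim: s => [_|w s IH /= /andP[ws us]].
  by rewrite big_nil (_ : _ `&` _ = set0) ?measure0//; apply/seteqP; split=> t [].
have ms : measurable (D `&` [set t | X n t \in s]).
  by apply: measurableI => //; exact: measurable_fiber.
rewrite big_cons -IH// -measureU//.
  congr (P _); apply/seteqP; split=> t /=.
    by move=> [Dt]; rewrite inE => /predU1P[|]; [left|right].
  by move=> [[Dt ->]|[Dt h]]; rewrite inE ?eqxx// h orbT.
by apply/seteqP; split=> t //= [[_ ->] [_]]; rewrite (negbTE ws).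
Qed.

Lemma sum_srw_step v (f : V -> R) :
  \sum_(w <- nb v) srw_step G R v w * f w = mean f v.
Proof.
rewrite /mean mulr_suml; apply: eq_big_seq => w; rewrite mem_nb// => vw.
by rewrite /srw_step vw mulrC.
Qed.

(** The transition probabilities to the neighbors of [v n] add up to 1, so up to a null set the next
    vertex splits the history into finitely many disjoint ones. *)
Lemma history_step v n (A : set T) : measurable A ->
  P (history X v n `&` A) =
  (\sum_(w <- nb (v n))
    P (history X (fun i => if i == n.+1 then w else v i) n.+1 `&` A))%E.
Proof.
move=> mA; have mH := measurable_history v n.
have us : uniq (nb (v n)) by exact: fset_uniq.
set s := nb (v n) in us *; set B := [set t | X n.+1 t \in s].
have mB : measurable B by exact: measurable_fiber.
have HB : P (history X v n `&` B) = P (history X v n).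
  rewrite /B sum_measure_fiber//.
  rewrite (eq_bigr (fun w => P (history X v n) * (srw_step G R (v n) w)%:E))%E;
    last first.
    by move=> w _; rewrite history_updateE.
  rewrite -ge0_sume_distrr; last by move=> w _; rewrite lee_fin /srw_step; case: ifP.
  rewrite sumEFin -[in X in X%:E](eq_bigr _ (fun w _ => mulr1 _)) sum_srw_step mean_cst.
  by rewrite mule1.
rewrite (measure_conull mH mA mB HB).
rewrite sum_measure_fiber//; last exact: measurableI.
apply: eq_bigr => w _; rewrite history_update; congr (P _).
by rewrite setIAC.
Qed.

Definition visits_between m n : set T :=
  [set t | exists i, [/\ (m <= i)%N, (i <= n)%N & X i t = x]].

Lemma measurable_visits m n : measurable (visits_between m n).
Proof.
rewrite (_ : visits_between m n =
    \bigcup_(i in [set i | (m <= i <= n)%N]) [set t | X i t = x]).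
  exact: bigcup_measurable.
apply/seteqP; split=> t; first by move=> [i [mi ni h]]; exists i => //=; rewrite mi.
by move=> [i /= /andP[mi ni] h]; exists i.
Qed.

(** The Markov property: [hit] obeys the one-step recursion of the walk. The time window starts at
    the end of the history, so it moves along with the induction. *)
Lemma history_hit v m n :
  P (history X v m `&` visits_between m (m + n)) =
  (P (history X v m) * (hit x n (v m))%:E)%E.
Proof.
elim: n v m => [|n IH] v m; have [vx|vx] := eqVneq (v m) x.
- rewrite vx hit_id mule1; congr (P _); apply/setIidPl => t h.
  by exists m; split; rewrite ?leq_addr// h.
- rewrite /= (negbTE vx) mule0 (_ : _ `&` _ = set0) ?measure0//.
  apply/seteqP; split=> t // -[h [i [mi]]]; rewrite addn0 => im.
  have -> : i = m by apply/eqP; rewrite eqn_leq im.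
  by rewrite h// => /eqP; rewrite (negbTE vx).
- rewrite vx hit_id mule1; congr (P _); apply/setIidPl => t h.
  by exists m; split; rewrite ?leq_addr// h.
rewrite (_ : _ `&` _ = history X v m `&` visits_between m.+1 (m.+1 + n)); last first.
  apply/seteqP; split=> t [h [i [mi ni it]]]; split=> //; exists i; split=> //.
  - rewrite ltn_neqAle mi andbT; apply/eqP => im; move/eqP: vx; apply.
    by rewrite -h// im.
  - by rewrite addSnnS.
  - exact: ltnW.
  - by rewrite -addSnnS.
rewrite history_step; last exact: measurable_visits.
rewrite (eq_bigr (fun w =>
  P (history X v m) * (srw_step G R (v m) w * hit x n w)%:E))%E.
  rewrite -ge0_sume_distrr; last first.
    by move=> w _; rewrite lee_fin mulr_ge0 ?hit_ge0// /srw_step; case: ifP.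
  by rewrite sumEFin sum_srw_step hitS.
move=> w _; rewrite IH eqxx history_update history_updateE EFinM muleA//.
Qed.

(** Time 0 does not count as a return, hence an average over the first step instead of
    [hit x n.+1 x], which is always 1. *)
Lemma visits_between_mean n : P (visits_between 1 n.+1) = (mean (hit x n) x)%:E.
Proof.
have H0 : history X (fun=> x) 0 = [set t | X 0%N t = x].
  by apply/seteqP; split=> t; [exact|move=> h i; rewrite leqn0 => /eqP->].
have P0 : P (history X (fun=> x) 0) = 1%E by rewrite H0; case: walk.
have mH : measurable (history X (fun=> x) 0) by exact: measurable_history.
rewrite -[X in P X]setTI.
rewrite (@measure_conull _ _ _ _ (measurable_visits _ _) mH)//; last first.
  by rewrite setTI P0 probability_setT.
rewrite setTI setIC.
rewrite history_step; last exact: measurable_visits.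
rewrite (eq_bigr (fun w => (srw_step G R x w * hit x n w)%:E))%E.
  by rewrite sumEFin sum_srw_step.
move=> w _; rewrite -add1n history_hit eqxx history_update.
by rewrite history_updateE P0 mul1e EFinM.
Qed.

Lemma returnsE : returns X x = \bigcup_n visits_between 1 n.+1.
Proof.
apply/seteqP; split=> [t [n [n0 nt]]|t [n _ [i [i1 _ it]]]]; last by exists i.
by exists n => //; exists n; split.
Qed.

Lemma measurable_returns : measurable (returns X x).
Proof.
by rewrite returnsE; apply: bigcup_measurable => n _; exact: measurable_visits.
Qed.

Lemma mean_hit_le_returns n : ((mean (hit x n) x)%:E <= P (returns X x))%E.
Proof.
rewrite -visits_between_mean le_measure ?inE//;
  [exact: measurable_visits|exact: measurable_returns|].
by rewrite returnsE => t h; exists n.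
Qed.

(** Continuity from below along the events of returning by time [n.+1]. *)
Lemma returns_le q : (forall n, mean (hit x n) x <= q) -> (P (returns X x) <= q%:E)%E.
Proof.
move=> hq; rewrite returnsE.
have := @nondecreasing_cvg_mu _ _ _ P (fun n => visits_between 1 n.+1).
move=> /(_ _ _ _)/cvg_lim <-//.
- apply: lime_le.
    apply: ereal_nondecreasing_is_cvgn => m n mn /=.
    rewrite !visits_between_mean lee_fin; apply: le_mean => w.
    exact: hit_nondecreasing.
  by apply: nearW => n /=; rewrite visits_between_mean lee_fin.
- by move=> n; exact: measurable_visits.
- by rewrite -returnsE; exact: measurable_returns.
- move=> m n mn; apply/subsetPset => t [i [i1 im it]]; exists i; split => //.
  exact: leq_trans im _.
Qed.

End Walk.
End Hitting.

(** * Generations of a radially symmetric tree *)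

Section RadialTree.
Variables (V : choiceType) (G : rooted_graph V).
Local Notation o := (root G).
Local Notation depth := (depth G).
Local Notation par := (par G).
Local Notation nb := (nb G).
Local Notation ch := (ch G).
Local Notation edge_above := (edge_above G).

Hypothesis proper : proper_infinite_tree G.
Hypothesis radial : radially_symmetric G.

Let tree : is_tree G. Proof. by case: proper. Qed.
Let locfin : locally_finite G. Proof. by case: proper. Qed.

(** The hypothesis on children concerns edges and does not reach the root. Infinitely many vertices
    give some [v != o], and climbing from [v] ends at a child of the root. *)
Lemma ch_root_neq0 : ch o != [::].
Proof.
have [v vo] : exists v, v != o.
  apply: contrapT => h; case: proper => _ infV _ _; apply: infV.
  apply: (@sub_finite_set _ _ [set o]); last exact: finite_set1.
  by move=> v _ /=; apply/eqP/negPn/negP => vo; apply: h; exists v.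
elim: {v}(depth v) {-2}v (erefl (depth v)) vo => [v /(depth0 tree)->|n IH v dv vo].
  by rewrite eqxx.
have [po|/IH] := eqVneq (par v) o.
  have : v \in ch o by rewrite mem_ch// vo po eqxx.
  by case: (ch o).
by apply; move: dv; rewrite (depth_par tree vo) => -[].
Qed.

Lemma ch_neq0 v : ch v != [::].
Proof.
have [->|vo] := eqVneq v o; first exact: ch_root_neq0.
case: proper => _ _ _ /(_ _ (edge_above_edges tree vo))[e'].
by rewrite children_above// => -[w /=]; case: (ch v).
Qed.

(** An arbitrary child, the default never being taken. Its iterates from the root supply one vertex
    per generation, where [branching] is read off. *)
Definition kid v := head o (ch v).

Lemma kid_ch v : kid v \in ch v.
Proof.
by rewrite /kid; have := ch_neq0 v; case: (ch v) => // a s _; exact: mem_head.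
Qed.

Definition branching n := size (ch (iter n kid o)).

Lemma branching_gt0 n : (0 < branching n)%N.
Proof. by rewrite lt0n size_eq0 ch_neq0. Qed.

Lemma depth_iter_kid n : depth (iter n kid o) = n.
Proof.
elim: n => [|n IH]; first exact: depth_root.
by rewrite iterS (depth_ch (kid_ch _)) IH.
Qed.

(** Radial symmetry is stated for edges and passes to a vertex through the edge above it; the root
    is alone in its generation. *)
Lemma size_ch v : size (ch v) = branching (depth v).
Proof.
have [->|vo] := eqVneq v o; first by rewrite depth_root.
have ro : iter (depth v) kid o != o.
  apply/eqP => /(congr1 depth); rewrite depth_iter_kid depth_root// => /(depth0 tree).
  by apply/eqP.
rewrite /branching -(num_children_above tree locfin vo).
rewrite -(num_children_above tree locfin ro).
apply: radial; try exact: edge_above_edges.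
by rewrite !generation_above// depth_iter_kid.
Qed.

(** The number of vertices of depth [n], which for [n > 0] is the number [N_n] of edges of
    generation [n]. *)
Definition level_size n := (\prod_(i < n) branching i)%N.

Lemma level_sizeS n : level_size n.+1 = (level_size n * branching n)%N.
Proof. by rewrite /level_size big_ord_recr. Qed.

Lemma level_size_gt0 n : (0 < level_size n)%N.
Proof. by rewrite prodn_gt0// => i; exact: branching_gt0. Qed.

Fixpoint level n : seq V :=
  if n is m.+1 then flatten [seq ch v | v <- level m] else [:: o].

Lemma depth_level n v : v \in level n -> depth v = n.
Proof.
elim: n v => [v|n IH v /= /flatten_mapP[u /IH <-]]; last exact: depth_ch.
by rewrite mem_seq1 => /eqP ->; exact: depth_root.
Qed.

Lemma mem_level v : v \in level (depth v).
Proof.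
elim: {v}(depth v) {-2}v (erefl (depth v)) => [v /(depth0 tree)->|n IH v dv].
  by rewrite depth_root// mem_seq1.
have vo : v != o by apply/eqP => vo; move: dv; rewrite vo depth_root.
rewrite dv; apply/flatten_mapP; exists (par v); last by rewrite mem_ch// vo eqxx.
by move: dv; rewrite (depth_par tree vo) => -[d]; have := IH _ d; rewrite d.
Qed.

Lemma size_level n : size (level n) = level_size n.
Proof.
elim: n => [|n IH]; first by rewrite /level_size big_ord0.
rewrite level_sizeS -IH /= size_flatten /shape -map_comp sumnE big_map.
rewrite (eq_big_seq (fun=> branching n)) => [|v /depth_level <-].
  by rewrite big_const_seq count_predT iter_addn_0 mulnC.
exact: size_ch.
Qed.

(** * The radial potential *)

Section Potential.
Variable R : realType.

Lemma sum_nb_depth (f : nat -> R) v : v != o ->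
  \sum_(w <- nb v) f (depth w) =
    f (depth v).-1 + (branching (depth v))%:R * f (depth v).+1.
Proof.
move=> vo; rewrite big_nb//; congr (_ + _); first by rewrite (depth_par tree vo).
rewrite (eq_big_seq (fun=> f (depth v).+1)) => [|w /depth_ch-> //].
by rewrite big_const_seq count_predT iter_addr_0 size_ch mulr_natl.
Qed.

Definition invN n : R := (level_size n)%:R^-1.

Lemma invN_gt0 n : 0 < invN n.
Proof. by rewrite invr_gt0 ltr0n level_size_gt0. Qed.

Lemma invNS n : (branching n)%:R * invN n.+1 = invN n.
Proof.
rewrite /invN level_sizeS natrM invfM mulrCA divff ?mulr1//.
by rewrite pnatr_eq0 -lt0n branching_gt0.
Qed.

(* The effective resistance between the root and generation [n]; as a function
   of the depth it is harmonic off the root. *)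
Definition resistance n : R := \sum_(i < n) invN i.+1.

Lemma resistanceS n : resistance n.+1 = resistance n + invN n.+1.
Proof. by rewrite /resistance big_ord_recr. Qed.

Lemma resistance0 : resistance 0 = 0.
Proof. by rewrite /resistance big_ord0. Qed.

Lemma resistance_lt : {homo resistance : m n / (m < n)%N >-> m < n}.
Proof.
apply: homo_ltn => [? ? ?|n]; first exact: lt_trans.
by rewrite resistanceS ltrDl invN_gt0.
Qed.

Lemma resistance_le : {homo resistance : m n / (m <= n)%N >-> m <= n}.
Proof. exact/ltW_homo/resistance_lt. Qed.

Lemma resistance_ge0 n : 0 <= resistance n.
Proof. by rewrite -resistance0 resistance_le. Qed.

(** At depth [n] with [b] children, the total increase towards the children is
    [b / N_(n+1) = 1 / N_n], which is the decrease towards the parent. *)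
Lemma resistance_harmonic v : v != o ->
  \sum_(w <- nb v) resistance (depth w) = (size (nb v))%:R * resistance (depth v).
Proof.
move=> vo; rewrite sum_nb_depth// nb_size// size_ch -natr1.
case: (depth v) (depth_par tree vo) => // n _ /=.
rewrite 2!resistanceS mulrDr invNS; ring.
Qed.

(** * Modulus *)

(** Paths are indexed from 0, generations from 1. The first edge contains the root, which can only
    be its upper end. *)
Lemma generation_path g i : infinite_descending_path G g -> generation G (g i) = i.+1.
Proof.
move=> [g0 og par_g]; elim: i => [|i IH]; last first.
  by case: (par_g i) => _ _ _ ->; rewrite IH.
have [v vo e] := edges_above tree g0.
move: og; rewrite e generation_above// !inE => /orP[/eqP po|/eqP vo'].
  by rewrite (depth_par tree vo) -po depth_root.
by rewrite vo' eqxx in vo.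
Qed.

(** Edges are reindexed by their lower ends and sorted by depth. Every vertex of depth [n.+1] occurs
    in the list [level n.+1], which bounds their number. *)
Lemma esum_radial_le (f : nat -> R) M : (forall n, 0 <= f n) ->
  (forall n, (M < n)%N -> f n = 0) ->
  (\esum_(e in edges G) (f (generation G e))%:E <=
   (\sum_(n < M) (level_size n.+1)%:R * f n.+1)%:E)%E.
Proof.
move=> f0 fM.
have -> : edges G = edge_above @` [set v | v != o].
  apply/seteqP; split=> [e /(edges_above tree)[v vo ->]|_ [v vo <-]].
    by exists v.
  exact: edge_above_edges.
rewrite esum_image => [|u v]; last by rewrite !inE => uo vo; exact: edge_above_inj.
pose a v n := (if depth v == n.+1 then f n.+1 else 0)%:E : \bar R.
have a0 v n : (0 <= a v n)%E by rewrite /a; case: ifP; rewrite lee_fin.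
apply: (@le_trans _ _ (\esum_(v in [set: V]) \sum_(n < M) a v n)%E).
  rewrite esum_mkcond; apply: le_esum => v _; case: ifPn => [|_]; last exact: sume_ge0.
  rewrite inE /= => vo; rewrite generation_above// (depth_par tree vo).
  case: (ltnP (depth (par v)) M) => h; last by rewrite fM ?sume_ge0.
  rewrite (bigD1 (Ordinal h))//= {1}/a (depth_par tree vo) eqxx.
  by rewrite leeDl// sume_ge0.
rewrite esum_sum; last by move=> *; exact: a0.
rewrite -sumEFin; apply: lee_sum => n _.
rewrite [leLHS](_ : _ = (\esum_(v in [set v | depth v = n.+1]) (f n.+1)%:E)%E);
  last first.
  rewrite [RHS]esum_mkcond; apply: eq_esum => v _; rewrite /a.
  by case: ifPn => [/eqP h|/eqP h]; [rewrite mem_set|rewrite memNset].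
have fin : finite_set [set v | depth v = n.+1].
  apply: (@sub_finite_set _ _ [set` level n.+1]); last exact: finite_seq.
  by move=> v dv; have := mem_level v; rewrite dv.
rewrite esum_fset//; last by move=> *; rewrite lee_fin.
rewrite fsbig_finite// sumEFin lee_fin big_const_seq count_predT iter_addr_0.
rewrite -[f _ *+ _]mulr_natl ler_wpM2r// ler_nat -size_level.
apply: uniq_leq_size; first exact: fset_uniq.
by move=> v; rewrite in_fset_set// inE => dv; have := mem_level v; rewrite dv.
Qed.

Lemma modulus_le0 (p : R) : 2 <= p -> (forall B, exists n, B < resistance n) ->
  (modulus G p <= 0)%E.
Proof.
move=> p2 unb; apply/lee_addgt0Pr => eps eps0; rewrite add0e.
(* [S > 1] keeps the values of the test function at most 1, so that [p]-th powers are below squares;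
   [S > 1 / eps] makes the energy bound [1 / S] smaller than [eps]. *)
have [M hM] := unb (Num.max 1 eps^-1); move: hM; rewrite gt_max => /andP[S1 Se].
set S := resistance M in S1 Se.
have S0 : 0 < S by exact: lt_trans S1.
pose f n := if (n <= M)%N then invN n / S else 0.
have f0 n : 0 <= f n.
  by rewrite /f; case: ifP => // _; rewrite divr_ge0 ?ltW// invN_gt0.
apply: (@le_trans _ _ (\esum_(e in edges G) (f (generation G e) `^ p)%:E)%E).
  apply: ereal_inf_lbound; exists (fun e => f (generation G e)) => //; split => // g gP.
  apply: le_trans (nneseries_lim_ge M _); last by move=> *; rewrite lee_fin.
  rewrite sumEFin lee_fin big_mkord (eq_bigr (fun i : 'I_M => invN i.+1 / S)).
    by rewrite -mulr_suml divff ?gt_eqF.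
  by move=> i _; rewrite generation_path// /f ltn_ord.
apply: le_trans (esum_radial_le (f := fun n => f n `^ p) (M := M) _ _) _.
- by move=> n; exact: powR_ge0.
- by move=> n; rewrite /f ltnNge => /negbTE->; rewrite powR0// gt_eqF//; lra.
(* Each generation contributes at most [N (1 / (N S))^2 = 1 / (N S^2)], and these add up to
   [S / S^2]. *)
rewrite lee_fin; apply: (@le_trans _ _ (\sum_(n < M) invN n.+1 / S ^+ 2)).
  apply: ler_sum => n _ /=; rewrite /f ltn_ord.
  have inv1 : invN n.+1 <= 1.
    by rewrite invf_le1 ?ltr0n ?level_size_gt0// ler1n level_size_gt0.
  have a1 : invN n.+1 / S <= 1.
    by rewrite ler_pdivrMr// mul1r (le_trans inv1)// ltW.
  have a0 : 0 < invN n.+1 / S by rewrite divr_gt0// invN_gt0.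
  apply: (@le_trans _ _ ((level_size n.+1)%:R * (invN n.+1 / S) ^+ 2)).
    by rewrite ler_wpM2l// -powR_mulrn ?(ltW a0)// ger_powR// a0 a1.
  have N0 : 0 < (level_size n.+1)%:R :> R by rewrite ltr0n level_size_gt0.
  rewrite [leLHS](_ : _ = invN n.+1 / S ^+ 2)// /invN.
  by field; rewrite !gt_eqF.
rewrite -mulr_suml -/(resistance M) -/S expr2 invfM mulrA divff ?gt_eqF// mul1r.
by rewrite ltW// -[ltRHS]invrK ltf_pV2// posrE// invr_gt0.
Qed.

(** The depth equation rules out iterating [par] past the root, where it is stationary. *)
Definition descendant v : set V :=
  [set w | exists n, iter n par w = v /\ depth w = (depth v + n)%N].

Lemma descendant_anc v w : descendant v w -> v = iter (depth w - depth v) par w.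
Proof. by move=> [n [<- ->]]; rewrite addKn. Qed.

Lemma descendant_ch v w : v != o -> descendant v w -> descendant (par v) w.
Proof.
move=> vo [n [vw dw]]; exists n.+1; rewrite iterS vw; split => //.
by rewrite dw {1}(depth_par tree vo) addSnnS.
Qed.

Definition energy (r : V -> R) v : \bar R :=
  \esum_(w in descendant v) (r w)%:E.

(** The subtrees of the children are disjoint and avoid [v]. All sums are extended by zero to [V],
    which reduces the inequality to a pointwise one. *)
Lemma energy_ch (r : V -> R) v : (forall w, 0 <= r w) ->
  ((r v)%:E + \sum_(c <- ch v) energy r c <= energy r v)%E.
Proof.
move=> r0; pose a (u w : V) := (if w \in descendant u then (r w)%:E else 0)%E.
have a0 u w : (0 <= a u w)%E by rewrite /a; case: ifP; rewrite // lee_fin.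
have -> : (r v)%:E = \esum_(w in [set: V]) (if w \in [set v] then (r w)%:E else 0)%E.
  by rewrite -esum_mkcond esum_set1// lee_fin.
rewrite (eq_bigr (fun c => \esum_(w in [set: V]) a c w)); last first.
  by move=> c _; rewrite /energy esum_mkcond.
rewrite -esum_sum// -esumD; [|by move=> w _; case: ifP; rewrite // lee_fin|
  by move=> w _; exact: sume_ge0].
rewrite /energy [leRHS]esum_mkcond; apply: le_esum => w _.
have [vw|vw] := boolP (w \in descendant v); last first.
  rewrite memNset; last first.
    by move=> /= wv; move/negP: vw; apply; rewrite inE wv; exists 0%N; rewrite addn0.
  rewrite add0e big_seq big1// => c; rewrite mem_ch// => /andP[co /eqP vc].
  rewrite /a memNset// => cw; move/negP: vw; apply; rewrite inE vc.
  exact: descendant_ch.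
have [/set_mem /= ->|wv] := boolP (w \in [set v]).
  rewrite big_seq big1 ?adde0// => c cv; rewrite /a memNset// => -[n [_]].
  by rewrite (depth_ch cv); lia.
rewrite add0e; have [[c cv cw]|no] := pselect (exists2 c, c \in ch v & descendant c w).
  rewrite (bigD1_seq c)//= ?ch_uniq//  big_seq_cond big1 ?adde0.
    by rewrite /a mem_set.
  move=> c' /andP[c'v c'c]; rewrite /a memNset// => c'w; move/eqP: c'c; apply.
  by rewrite (descendant_anc c'w) (descendant_anc cw) !(depth_ch c'v, depth_ch cv).
rewrite big_seq big1 ?lee_fin// => c cv; rewrite /a memNset// => cw.
by apply: no; exists c.
Qed.

(** The lightest of [b] children has at most a [1 / b] share of the energy left below [v], and the
    factors [b] met on the way down multiply to [level_size]. *)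
Lemma light_path (r : V -> R) (E : R) : (forall w, 0 <= r w) ->
  (energy r o <= E%:E)%E ->
  exists g : nat -> V, [/\ g 0%N = o, forall n, g n.+1 \in ch (g n) &
    forall n, \sum_(i < n) (level_size i)%:R * r (g i) <= E].
Proof.
move=> r0 oE.
have ge0 v : (0 <= energy r v)%E by apply: esum_ge0 => w _; rewrite lee_fin.
have leE v : (energy r v <= E%:E)%E.
  elim: {v}(depth v) {-2}v (erefl (depth v)) => [v /(depth0 tree)-> //|n IH v dv].
  have vo : v != o by apply/eqP => vo; move: dv; rewrite vo depth_root.
  have : (energy r v <= energy r (par v))%E.
    rewrite /energy esum_mkcond [leRHS]esum_mkcond; apply: le_esum => w _.
    case: ifPn => [/set_mem vw|_]; last by case: ifP; rewrite lee_fin.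
    by rewrite mem_set//; exact: descendant_ch.
  move=> /le_trans; apply; apply: IH.
  by move: dv; rewrite (depth_par tree vo) => -[].
have fin v : energy r v \is a fin_num.
  by rewrite ge0_fin_numE// (le_lt_trans (leE v))// ltry.
pose e v := fine (energy r v).
have eE v : energy r v = (e v)%:E by rewrite fineK.
have e0 v : 0 <= e v by rewrite fine_ge0.
have step v : exists2 c, c \in ch v & (size (ch v))%:R * e c <= e v - r v.
  have [c cv ec] := exists_le_mean e (ch_neq0 v); exists c => //.
  apply: le_trans ec _; rewrite lerBrDl -lee_fin EFinD -sumEFin -eE.
  by apply: le_trans (energy_ch v r0); rewrite leeD2l// lee_sum// => w _; rewrite eE.
have /choice[F FP] v : exists c, c \in ch v /\ (size (ch v))%:R * e c <= e v - r v.
  by have [c ? ?] := step v; exists c.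
exists (fun n => iter n F o); split=> [//|n|n]; first by have [] := FP (iter n F o).
(* With the weighted energy of the remaining subtree added, the quantity does not increase with [n],
   and it starts at the energy of the root. *)
apply: (@le_trans _ _ (\sum_(i < n) (level_size i)%:R * r (iter i F o) +
  (level_size n)%:R * e (iter n F o))).
  by rewrite lerDl mulr_ge0.
have dF n' : depth (iter n' F o) = n'.
  elim: n' => [|m IH]; first exact: depth_root.
  by rewrite iterS (depth_ch (FP _).1) IH.
elim: n => [|n IH].
  by rewrite big_ord0 add0r /level_size big_ord0 mul1r -lee_fin -eE.
apply: le_trans IH; rewrite big_ord_recr/= -addrA lerD2l.
rewrite level_sizeS natrM -mulrA -mulrDr ler_wpM2l// -lerBrDl.
by have [_] := FP (iter n F o); rewrite size_ch dF.
Qed.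

Lemma modulus2_gt0 (B : R) : (forall n, resistance n <= B) -> (0 < modulus G (2 : R))%E.
Proof.
move=> hB; have B0 : 0 < B.
  by apply: lt_le_trans (hB 1%N); rewrite -resistance0 resistance_lt.
(* An admissible function of energy [E < 1 / B] would leave some descending path of length at most
   [(B E + 1) / 2 < 1]. *)
apply: (@lt_le_trans _ _ B^-1%:E); first by rewrite lte_fin invr_gt0.
apply: le_ereal_inf_tmp => _ [rho [rho0 rhoA] <-].
set E := esum _ _.
have [|EB] := leP B^-1%:E E => //.
have E0 : (0 <= E)%E by apply: esum_ge0 => e _; rewrite lee_fin powR_ge0.
have Efin : E \is a fin_num by rewrite ge0_fin_numE// (lt_trans EB)// ltry.
(* The weight of an edge is moved to its lower end; the root has no edge above it and gets 0. *)
pose r v := if v == o then 0 else rho (edge_above v) `^ 2.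
have r0 v : 0 <= r v by rewrite /r; case: ifP => // _; exact: powR_ge0.
have rE : (energy r o <= (fine E)%:E)%E.
  rewrite fineK// /E.
  have -> : edges G = edge_above @` [set v | v != o].
    apply/seteqP; split=> [e /(edges_above tree)[v vo ->]|_ [v vo <-]].
      by exists v.
    exact: edge_above_edges.
  rewrite esum_image => [|u v]; last by rewrite !inE => uo vo; exact: edge_above_inj.
  rewrite /energy esum_mkcond [leRHS]esum_mkcond; apply: le_esum => v _.
  have [->|vo] := eqVneq v o.
    have /negbTE-> : o \notin [set v | v != o].
      by apply/negP => /set_mem /=; rewrite eqxx.
    by rewrite /r eqxx; case: ifP.
  have -> : v \in [set v | v != o] by exact: mem_set.
  by case: ifP => _; [rewrite /r (negbTE vo)|rewrite lee_fin powR_ge0].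
have [g [go gch gE]] := light_path r0 rE.
have gS n : g n.+1 != o by have := gch n; rewrite mem_ch// => /andP[].
have dg n : depth (g n) = n.
  elim: n => [|n IH]; first by rewrite go depth_root.
  by rewrite (depth_ch (gch n)) IH.
have gP : infinite_descending_path G (fun i => edge_above (g i.+1)).
  split; first exact: edge_above_edges.
    have := gch 0%N; rewrite go mem_ch// => /andP[_ /eqP po].
    by rewrite /edge_above !inE -po eqxx.
  move=> i; have : children G (edge_above (g i.+1)) (edge_above (g i.+2)).
    by rewrite children_above//; exists (g i.+2) => //=; exact: gch.
  by [].
have rho0' i : 0 <= rho (edge_above (g i.+1)) by apply: rho0; exact: edge_above_edges.
have /(le_trans (rhoA _ gP)) : (path_length rho (fun i => edge_above (g i.+1)) <=
    (2^-1 * (B * fine E + 1))%:E)%E.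
  apply: lime_le; first by apply: is_cvg_nneseries => i _ _; rewrite lee_fin.
  apply: nearW => n; rewrite sumEFin lee_fin big_mkord.
  (* AM-GM: [rho <= (B * N * rho^2 + 1 / (B * N)) / 2] on the edge
     of generation [i + 1]. *)
  apply: (@le_trans _ _ (2^-1 * (B * \sum_(i < n) (level_size i.+1)%:R * r (g i.+1) +
      B^-1 * resistance n))).
    rewrite /resistance !mulr_sumr -big_split mulr_sumr; apply: ler_sum => i _ /=.
    rewrite /r (negbTE (gS i)) powR_mulrn//.
    set x := rho _; rewrite /invN; set N := (level_size _)%:R.
    have N0 : 0 < N by rewrite ltr0n level_size_gt0.
    rewrite ler_pdivlMl// -subr_ge0.
    have -> : B * (N * x ^+ 2) + B^-1 * N^-1 - 2 * x = (B * N * x - 1) ^+ 2 / (B * N).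
      by field; rewrite !gt_eqF.
    by rewrite divr_ge0 ?sqr_ge0// mulr_ge0// ltW.
  rewrite ler_pM2l ?invr_gt0//; apply: lerD.
    (* The extra first term in [gE n.+1] belongs to the root and vanishes. *)
    rewrite ler_pM2l//; have := gE n.+1.
    by rewrite big_ord_recl /= go /r eqxx mulr0 add0r.
  by rewrite -[leRHS](mulVf (x := B)) ?gt_eqF// ler_pM2l ?invr_gt0.
rewrite lee_fin ler_pdivlMl// mulr1 -lerBlDr => /le_lt_trans; move/(_ 1).
have BE : B * fine E < 1 by rewrite -ltr_pdivlMl// mulr1 -lte_fin fineK.
by move=> /(_ BE); lra.
Qed.

(** * Superharmonic functions *)

Lemma nb_neq0 v : nb v != [::].
Proof. by have := ch_neq0 v; rewrite /ch; case: (nb v). Qed.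

Let size_nb0 v : 0 < (size (nb v))%:R :> R.
Proof. exact/size_nb_gt0/nb_neq0. Qed.

Definition superharmonic_at (f : V -> R) v := mean G f v <= f v.

(** The differences [f w - f u] over the neighbors are nonnegative and their sum is at most 0. *)
Lemma superharmonic_min f u : superharmonic_at f u ->
  (forall w, w \in nb u -> f u <= f w) -> forall w, w \in nb u -> f w = f u.
Proof.
rewrite /superharmonic_at /mean ler_pdivrMr// => hf fmin w wu.
apply/eqP; rewrite eq_le fmin// andbT -subr_le0.
have : \sum_(z <- nb u) (f z - f u) <= 0.
  by rewrite sumrB big_const_seq count_predT iter_addr_0 -[f u *+ _]mulr_natr subr_le0.
apply: le_trans; rewrite (bigD1_seq w) ?nb_uniq//= lerDl big_seq_cond.
by apply: sumr_ge0 => z /andP[zu _]; rewrite subr_ge0 fmin.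
Qed.

(** The root is exempt from superharmonicity because the potential, minimal there, is not
    superharmonic at it. *)
Lemma minimum_principle (f : V -> R) M :
  (forall u, u != o -> (depth u < M)%N -> superharmonic_at f u) ->
  (forall u, depth u = M -> f o <= f u) ->
  forall v, (depth v <= M)%N -> f o <= f v.
Proof.
move=> hf hM v vM; pose ball := flatten [seq level n | n <- iota 0 M.+1].
have ballP u : (u \in ball) = (depth u <= M)%N.
  apply/flatten_mapP/idP => [[n]|uM].
    by rewrite mem_iota add0n ltnS => nM /depth_level ->.
  by exists (depth u); [rewrite mem_iota|exact: mem_level].
have [|u uB umin] := @exists_min _ V ball f.
  by apply: contraL vM => /eqP b0; rewrite -ballP b0.
apply: le_trans (umin v _); last by rewrite ballP.
(* A minimizer inside the ball passes its value to its parent, so the minimum climbs to the root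
   unless it sits at depth [M]. *)
elim: {u}(depth u) {-2}u (erefl (depth u)) uB umin =>
  [u /(depth0 tree)-> //|n IH u du uB umin].
have uo : u != o by apply/eqP => uo; move: du; rewrite uo depth_root.
have [/hM//|uM] := eqVneq (depth u) M.
have {}uM : (depth u < M)%N by rewrite ltn_neqAle uM -ballP.
have fpar : f (par u) = f u.
  apply: superharmonic_min (hf _ uo uM) _ _ _.
    move=> w; rewrite mem_nb// => /(adj_cases tree) uw; apply: umin; rewrite ballP.
    case: uw => [[wo uw]|[_ ->]]; first by rewrite (depth_par tree wo) -uw.
    by rewrite (leq_trans _ (ltnW uM))// (depth_par tree uo).
  by rewrite mem_nb// adjC// adj_par.
rewrite -fpar; apply: IH => [||w wB]; last by rewrite fpar umin.
  by move: du; rewrite (depth_par tree uo) => -[].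
by rewrite ballP (leq_trans _ (ltnW uM))// (depth_par tree uo).
Qed.

Lemma mean_resistance v : v != o ->
  mean G (fun w => resistance (depth w)) v = resistance (depth v).
Proof. by move=> vo; rewrite /mean resistance_harmonic// mulrC mulKf ?gt_eqF. Qed.

Lemma meanD (f g : V -> R) v : mean G (fun w => f w + g w) v = mean G f v + mean G g v.
Proof. by rewrite /mean big_split mulrDl. Qed.

Lemma meanZ (a : R) (f : V -> R) v : mean G (fun w => a * f w) v = a * mean G f v.
Proof. by rewrite /mean -mulr_sumr mulrA. Qed.

Lemma superharmonic_root_le (f : V -> R) : (forall B, exists n, B < resistance n) ->
  (forall v, 0 <= f v) -> (forall v, superharmonic_at f v) -> forall v, f o <= f v.
Proof.
move=> unb f0 hf v; have [//|fv] := leP (f o) (f v).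
(* Small enough that the potential adds less than [f o - f v] at [v]. Far away it still exceeds
   [f o], which is the boundary condition at depth [M]. *)
pose eps := (f o - f v) / (2 * (resistance (depth v) + 1)).
have r1 : 0 < resistance (depth v) + 1 by rewrite ltr_wpDl// resistance_ge0.
have eps0 : 0 < eps by rewrite divr_gt0 ?subr_gt0// mulr_gt0.
have [M0 hM0] := unb (f o / eps); pose M := maxn M0 (depth v).
pose W w := f w + eps * resistance (depth w).
have : W o <= W v.
  apply: (@minimum_principle W M _ _ v (leq_maxr _ _)).
    move=> u uo _; rewrite /superharmonic_at /W meanD meanZ mean_resistance// lerD2r.
    exact: hf.
  move=> u uM; rewrite /W depth_root// resistance0 mulr0 addr0 -[leLHS]add0r lerD// uM.
  rewrite mulrC -ler_pdivrMr// ltW// (lt_le_trans hM0)// resistance_le//.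
  exact: leq_maxl.
rewrite /W depth_root// resistance0 mulr0 addr0.
have : eps * resistance (depth v) < f o - f v.
  rewrite /eps mulrAC ltr_pdivrMr ?mulr_gt0// ltr_pM2l ?subr_gt0//.
  by have := resistance_ge0 (depth v); lra.
by lra.
Qed.

(** Once the parent attains the minimum [f o], all its neighbors do, so the value spreads down the
    tree. *)
Lemma superharmonic_cst (f : V -> R) : (forall B, exists n, B < resistance n) ->
  (forall v, 0 <= f v) -> (forall v, superharmonic_at f v) -> forall v, f v = f o.
Proof.
move=> unb f0 hf v; have fo := superharmonic_root_le unb f0 hf.
elim: {v}(depth v) {-2}v (erefl (depth v)) => [v /(depth0 tree)-> //|n IH v dv].
have vo : v != o by apply/eqP => vo; move: dv; rewrite vo depth_root.
have fp : f (par v) = f o by apply: IH; move: dv; rewrite (depth_par tree vo) => -[].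
rewrite -fp; apply: superharmonic_min (hf _) _ _ _ => [w _|]; first by rewrite fp.
by rewrite mem_nb// adj_par.
Qed.

(** * Return probabilities in the two cases *)

Lemma mean_hit_cvg x : (forall B, exists n, B < resistance n) ->
  mean G (hit G R x n) x @[n --> \oo] --> (1 : R).
Proof.
move=> unb; pose F y : R := limn (fun n => hit G R x n y).
have hF y : hit G R x n y @[n --> \oo] --> F y.
  apply: nondecreasing_is_cvgn; first exact: hit_nondecreasing.
  by exists 1 => _ [n _ <-]; apply: hit_le1; exact: nb_neq0.
have mF y : mean G (hit G R x n) y @[n --> \oo] --> mean G F y.
  rewrite /mean; apply: cvgM; last exact: cvg_cst.
  by apply: (cvg_big add_continuous) => w _; exact: hF.
have Fx : F x = 1.
  by rewrite /F (_ : (fun n => _) = cst 1) ?lim_cst//; apply/funext => n; exact: hit_id.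
have F1 y : F y <= 1.
  by apply: limr_le; [apply: hF|apply: nearW => n; apply: hit_le1; exact: nb_neq0].
have F0 y : 0 <= F y.
  by apply: limr_ge; [apply: hF|apply: nearW => n; exact: hit_ge0].
(* At [x] the value 1 is the maximum of [F]; elsewhere the recursion of [hit] passes to the
   limit. *)
have supF y : superharmonic_at F y.
  have [->|yx] := eqVneq y x.
    by rewrite /superharmonic_at Fx -[leRHS](mean_cst nb_neq0 1 x) le_mean.
  have : mean G (hit G R x n) y @[n --> \oo] --> F y.
    rewrite (_ : (fun n => _) = fun n => hit G R x n.+1 y).
      by rewrite (cvg_shiftS (fun n => hit G R x n y)).
    by apply/funext => n; rewrite hitS.
  by move=> /(cvg_unique _ (mF y)) h; rewrite /superharmonic_at h.
have FE y : F y = 1.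
  rewrite (superharmonic_cst unb F0 supF) -Fx.
  exact/esym/(superharmonic_cst unb F0 supF).
rewrite -[X in _ --> X](mean_cst nb_neq0 1 x).
by have := mF x; rewrite (_ : F = fun=> 1)//; apply/funext.
Qed.

Lemma mean_hit_bounded x B : (forall n, resistance n <= B) ->
  exists2 q : R, q < 1 & forall n, mean G (hit G R x n) x <= q.
Proof.
move=> hB; have hlt n : resistance n < B.
  by apply: lt_le_trans (hB n.+1); exact: resistance_lt.
have Bx : 0 < B - resistance (depth x) by rewrite subr_gt0.
(* Affine in the potential, equal to 1 at [x], decreasing with depth and positive since [resistance]
   stays strictly below [B]. *)
pose f v := (B - resistance (depth v)) / (B - resistance (depth x)).
pose g v := Num.min 1 (f v).
have fE v : f v = B / (B - resistance (depth x)) +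
    - (B - resistance (depth x))^-1 * resistance (depth v).
  by rewrite /f; field; rewrite gt_eqF.
have supf v : mean G f v <= f v.
  rewrite (_ : f = fun v => B / (B - resistance (depth x)) +
    - (B - resistance (depth x))^-1 * resistance (depth v)); last exact/funext.
  rewrite meanD mean_cst ?lerD2l ?meanZ; last exact: nb_neq0.
  (* At the root the potential is smallest, so [f] is largest there and its mean cannot exceed
     it. *)
  have [->|vo] := eqVneq v o; last by rewrite mean_resistance.
  rewrite depth_root// resistance0 mulr0 mulNr oppr_le0 mulr_ge0 ?invr_ge0 ?(ltW Bx)//.
  by apply: mean_ge0 => w; exact: resistance_ge0.
have supg v : mean G g v <= g v.
  rewrite /g le_min; apply/andP; split.
    by rewrite -[leRHS](mean_cst nb_neq0 1 v) le_mean// => w; rewrite ge_min lexx.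
  by apply: le_trans (supf v); apply: le_mean => w; rewrite ge_min lexx orbT.
have gx : g x = 1 by rewrite /g /f divff ?gt_eqF// minxx.
have hg n y : hit G R x n y <= g y.
  elim: n y => [|n IH] y; (have [->|yx] := eqVneq y x; first by rewrite hit_id gx).
    rewrite /= (negbTE yx) le_min ler01 divr_ge0// ?(ltW Bx)//.
    by rewrite subr_ge0 hB.
  by rewrite hitS// (le_trans _ (supg y))// le_mean.
exists (mean G g x); last by move=> n; exact: le_mean.
have kx := kid_ch x.
have gk : g (kid x) < 1.
  rewrite gt_min ltr_pdivrMr// mul1r ltrD2l ltrN2 (depth_ch kx) orbC.
  by rewrite resistance_lt.
(* Otherwise [- g] is superharmonic at [x] and minimal there, which forces [g = 1] at every
   neighbor, including [kid x]. *)
rewrite ltNge; apply/negP => g1.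
have : - g (kid x) = - g x.
  apply: (@superharmonic_min (fun w => - g w)).
  - rewrite /superharmonic_at (_ : (fun w => - g w) = fun w => -1 * g w).
      by rewrite meanZ mulN1r lerN2 gx.
    by apply/funext => w; rewrite mulN1r.
  - by move=> w _; rewrite lerN2 gx ge_min lexx.
  - by move: kx; rewrite mem_filter => /andP[].
by move/oppr_inj => gkx; rewrite gkx gx ltxx in gk.
Qed.

End Potential.
End RadialTree.

(** * Recurrence and transience criteria *)

Section Criteria.
Variables (R : realType) (V : choiceType) (G : rooted_graph V).
Hypothesis proper : proper_infinite_tree G.
Hypothesis radial : radially_symmetric G.

Let locfin : locally_finite G. Proof. by case: proper. Qed.
Let nbN0 v : nb G v != [::]. Proof. exact: nb_neq0. Qed.

Lemma bounded_resistance_transient B :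
  (forall n, resistance G R n <= B) -> srw_transient G R.
Proof.
move=> hB d T P X x walk.
have [q q1 hq] := mean_hit_bounded proper radial x hB.
apply: le_lt_trans (returns_le locfin nbN0 walk hq) _.
by rewrite lte_fin.
Qed.

Lemma unbounded_resistance_recurrent :
  (forall B, exists n, B < resistance G R n) -> srw_recurrent G R.
Proof.
move=> unb d T P X x walk; apply/eqP; rewrite eq_le; apply/andP; split.
  exact/probability_le1/(measurable_returns walk).
have fin : P (returns X x) \is a fin_num.
  exact/fin_num_measure/(measurable_returns walk).
rewrite -(fineK fin) lee_fin; have cv := @mean_hit_cvg _ _ proper radial _ x unb.
rewrite -(cvg_lim _ cv)//; apply: limr_le; first exact: cvgP cv.
by apply: nearW => n; rewrite -lee_fin fineK//; exact: mean_hit_le_returns.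
Qed.

End Criteria.

Theorem theorem13 (R : realType) (V : choiceType) (G : rooted_graph V)
    (hG : one_two_tree G) :
  ((2%:E < critical_exponent G R)%E -> srw_transient G R) /\
  ((critical_exponent G R < 2%:E)%E -> srw_recurrent G R).
Proof.
case: hG => proper radial _.
(* In each case one implication holds by its conclusion and the other because its premise fails. *)
have [unb|bdd] := pselect (forall B, exists n, B < resistance G R n); last first.
  have {bdd}[B hB] : exists B, forall n, resistance G R n <= B.
    apply: contrapT => h; apply: bdd => B; apply: contrapT => hn; apply: h.
    by exists B => n; rewrite leNgt; apply/negP => ?; apply: hn; exists n.
  split=> [_|]; first exact: bounded_resistance_transient hB.
  (* Here 2 is itself a positive exponent, so the critical exponent is at least 2. *)
  have p2 : positive_exponents G (2 : R).
    by split; [rewrite ltr1n|exact: modulus2_gt0 hB].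
  rewrite /critical_exponent; case: ifPn => [/eqP p0|_].
    by move: p2; rewrite p0.
  by rewrite ltNge ereal_sup_ubound//; exists 2.
split=> [|_]; last exact: unbounded_resistance_recurrent.
rewrite /critical_exponent; case: ifPn => _; first by rewrite lte_fin ltrn1.
(* A supremum above 2 would yield some [p > 2] of positive modulus. *)
move=> /ereal_sup_gt[_ [p [_ mp] <-]]; rewrite lte_fin => p2.
have := modulus_le0 proper radial (ltW p2) unb.
by rewrite leNgt mp.
Qed.
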